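(* Let $\mathbf{k}=(k_1,\dots,k_s)$ be a sequence of positive integers with $\sum_{i=1}^s k_i=n$, and put $n_0=0$, $n_i=\sum_{j=1}^i k_j$. Let $\lambda=(\lambda_1,\dots,\lambda_n)$ be real numbers with $\lambda_1=\cdots=\lambda_{n_1}>\lambda_{n_1+1}=\cdots=\lambda_{n_2}>\cdots>\lambda_{n_{s-1}+1}=\cdots=\lambda_{n_s}$. Then there is a bijection $\phi:\mathcal{F}(\mathcal{P}_\lambda)\to\mathcal{F}(\Gamma_{\mathbf{k}})$ from the set of (nonempty) faces of the Gelfand–Cetlin polytope $\mathcal{P}_\lambda$ to the set of faces of the ladder diagram $\Gamma_{\mathbf{k}}$ such that for all faces $F,F'$ of $\mathcal{P}_\lambda$: $F\subseteq F'$ if and only if $\phi(F)\subseteq\phi(F')$, and $\dim\phi(F)=\dim F$. In particular $\phi$ is an isomorphism of face lattices preserving dimension.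
   Context: Gelfand–Cetlin polytope: let $I=\{(i,j)\in\mathbb{Z}^2: i,j\ge1,\ i+j\le n\}$ and $d=|I|=\binom n2$. With coordinates $(x_{i,j})_{(i,j)\in I}$ on $\mathbb{R}^d$ and the convention $x_{i,n+1-i}:=\lambda_i$ for $i=1,\dots,n$, $\mathcal{P}_\lambda=\{x\in\mathbb{R}^d: x_{i,j+1}\ge x_{i,j}\ge x_{i+1,j}\text{ for all }(i,j)\in I\}$. Let $Q^+$ be the infinite directed graph with vertex set $\mathbb{Z}_{\ge0}\times\mathbb{Z}_{\ge0}$ and a directed edge $((i,j),(i',j'))$ iff $(i',j')=(i,j+1)$ or $(i',j')=(i+1,j)$. Terminal vertices: $T_{\mathbf{k}}=\{(n_\ell,n-n_\ell):0\le\ell\le s\}$. The ladder diagram $\Gamma_{\mathbf{k}}$ is the induced subgraph of $Q^+$ on the vertex set $\{(a,b): a\le c,\ b\le d\text{ for some }(c,d)\in T_{\mathbf{k}}\}$. The vertex $(0,0)$ is the origin. A positive path is a shortest (directed) path in $\Gamma_{\mathbf{k}}$ from the origin to a terminal vertex. A face of $\Gamma_{\mathbf{k}}$ is a subgraph $\gamma$ whose vertex set contains all terminal vertices and which is a union of positive paths; $\mathcal{F}(\Gamma_{\mathbf{k}})$ denotes the set of faces, ordered by inclusion of subgraphs. The dimension of a face $\gamma$ is $\operatorname{rank}H_1(\gamma)$, regarding $\gamma$ as a 1-dimensional CW complex (the number of independent cycles). *)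

(* Defs.v *)
From HB Require Import structures.
From mathcomp Require Import all_boot all_order all_algebra.
Unset Printing Implicit Defensive.
Import Order.TTheory GRing.Theory Num.Theory.

(* Index set I = {(i,j) : i,j >= 1, i+j <= n}; coordinates of R^d, d = 'C(n,2). *)
Definition GCidx_pred (n : nat) (p : 'I_n.+1 * 'I_n.+1) : bool :=
  [&& (0 < nat_of_ord p.1)%N, (0 < nat_of_ord p.2)%N & (nat_of_ord p.1 + nat_of_ord p.2 <= n)%N].
Definition GCidx (n : nat) := {p : 'I_n.+1 * 'I_n.+1 | GCidx_pred n p}.
Local Open Scope ring_scope.


(* lambda_i for 1 <= i <= n (lam is 0-based: lambda_i = lam (i-1)). *)
Definition lamat (R : realFieldType) (n : nat) (lam : 'I_n -> R) (i : nat) : R :=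
  if i is k.+1 then oapp lam 0 (insub k) else 0.

(* x_{i,j} with the convention x_{i,n+1-i} := lambda_i. *)
Definition xe (R : realFieldType) (n : nat) (lam : 'I_n -> R)
    (x : GCidx n -> R) (i j : nat) : R :=
  match [pick p : GCidx n | ((sval p).1 == i :> nat) && ((sval p).2 == j :> nat)] with
  | Some p => x p
  | None => if (i + j == n.+1)%N then lamat R n lam i else 0
  end.

Definition inGC (R : realFieldType) (n : nat) (lam : 'I_n -> R) (x : GCidx n -> R) : Prop :=
  forall p : GCidx n,
    xe R n lam x (sval p).1 (sval p).2 <= xe R n lam x (sval p).1 (sval p).2.+1 /\
    xe R n lam x (sval p).1.+1 (sval p).2 <= xe R n lam x (sval p).1 (sval p).2.

(* (nonempty) faces: nonempty intersections of P with a supporting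
   "maximise a linear functional" hyperplane (c = 0 gives P itself). *)
Definition is_Pface (R : realFieldType) (n : nat) (lam : 'I_n -> R)
    (F : (GCidx n -> R) -> Prop) : Prop :=
  (exists x, F x) /\
  exists c : GCidx n -> R, forall x,
    F x <-> (inGC R n lam x /\
             forall y, inGC R n lam y -> \sum_p c p * y p <= \sum_p c p * x p).

Definition aff_indep (R : realFieldType) (n m : nat) (pts : 'I_m -> (GCidx n -> R)) : Prop :=
  forall c : 'I_m -> R, \sum_i c i = 0 ->
    (forall p, \sum_i c i * pts i p = 0) -> forall i, c i = 0.

Definition affdim (R : realFieldType) (n : nat) (F : (GCidx n -> R) -> Prop) (k : nat) : Prop :=
  (exists pts : 'I_k.+1 -> (GCidx n -> R), (forall i, F (pts i)) /\ aff_indep R n _ pts) /\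
  ~ (exists pts : 'I_k.+2 -> (GCidx n -> R), (forall i, F (pts i)) /\ aff_indep R n _ pts).

Local Close Scope ring_scope.

(* vertices of Gamma_k all lie in {0..n} x {0..n} *)
Definition LV (n : nat) := ('I_n.+1 * 'I_n.+1)%type.

Definition nl (k : seq nat) (l : nat) : nat := sumn (take l k).

Definition terminal (k : seq nat) (n : nat) (v : LV n) : bool :=
  has (fun l => (v.1 == nl k l :> nat) && (v.2 == (n - nl k l)%N :> nat))
      (iota 0 (size k).+1).

Definition inGamma (k : seq nat) (n : nat) (v : LV n) : bool :=
  has (fun l => (v.1 <= nl k l)%N && (v.2 <= n - nl k l)%N) (iota 0 (size k).+1).

Definition qstep (n : nat) (u v : LV n) : bool :=
  ((v.1 == u.1 :> nat) && (v.2 == (u.2).+1 :> nat)) ||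
  ((v.1 == (u.1).+1 :> nat) && (v.2 == u.2 :> nat)).

Definition gstep (k : seq nat) (n : nat) (u v : LV n) : bool :=
  [&& qstep n u v, inGamma k n u & inGamma k n v].

Definition origin (n : nat) : LV n := (ord0, ord0).

(* a positive path is  origin :: r ; here represented by its tail r.
   (Every directed path in Q^+ from the origin to (c,d) has length c+d,
   hence is automatically shortest.) *)
Definition pos_path (k : seq nat) (n : nat) (r : seq (LV n)) : bool :=
  path (gstep k n) (origin n) r && terminal k n (last (origin n) r).

Definition gsub (n : nat) := ({set LV n} * {set LV n * LV n})%type.

Definition gsubset (n : nat) (g g' : gsub n) : bool :=
  (g.1 \subset g'.1) && (g.2 \subset g'.2).

Definition is_Gface (k : seq nat) (n : nat) (g : gsub n) : Prop :=
  (forall v, terminal k n v -> v \in g.1) /\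
  exists ps : seq (seq (LV n)),
    all (pos_path k n) ps /\
    g.1 = [set v | has (fun r => v \in origin n :: r) ps] /\
    g.2 = [set e | has (fun r => e \in zip (origin n :: r) r) ps].

(* rank H_1 of a graph = #edges - #vertices + #connected components *)
Definition gadj (n : nat) (g : gsub n) : rel (LV n) :=
  fun u v => ((u, v) \in g.2) || ((v, u) \in g.2).

Definition ncomp (n : nat) (g : gsub n) : nat :=
  #|[set fingraph.root (gadj n g) v | v in g.1]|.

Definition gdim (n : nat) (g : gsub n) : nat :=
  (#|g.2| + ncomp n g - #|g.1|)%N.

(* Main.v *)
Require Import Defs.
From HB Require Import structures.
From mathcomp Require Import all_boot all_order all_algebra.
From mathcomp Require Import zify ring lra boolp.
Import Order.TTheory GRing.Theory Num.Theory.

(** Place the coordinate [x_(i,j)] in the unit box with upper right corner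
    [(i, j)].  The inequality between two adjacent boxes is attached to the edge
    they share, and a point [x] of the polytope is sent to the graph formed by the
    axes and the edges whose inequality is strict at [x].  Comparing the four boxes
    around a vertex, this graph enters a vertex iff it leaves it, and it meets the
    antidiagonal exactly in the terminal vertices; hence it is a union of positive
    paths.  Conversely, given a union of positive paths, the weighted sum of the
    indicator functions of the regions to the left of the paths, with weights
    adding up to [lambda_m - lambda_(m+1)] over the paths ending in column [m], is a
    point of the polytope whose strict inequalities are exactly the edges of the paths.
    A face of the polytope is the set of points whose strict inequalities are among
    those of a generic point of it.  Its dimension is the number of boxes lying
    strictly between the boxes above and to the right, i.e. the number of vertices
    of in-degree 2, which is the first Betti number of the graph. *)

(** * Lattice paths, and graphs given by their entering edges *)

Section StepGraphs.

Variable n : nat.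
Implicit Types (H V : nat -> nat -> bool) (u v w o : LV n) (r : seq (LV n)).

Lemma vertex_of_coords (a b : nat) : a <= n -> b <= n ->
  {v : LV n | v.1 = a :> nat & v.2 = b :> nat}.
Proof.
move=> an bn; exists (inord a, inord b) => /=; by rewrite inordK // ltnS.
Qed.

Lemma qstep_path_level u r : path (qstep n) u r ->
  (last u r).1 + (last u r).2 = u.1 + u.2 + size r.
Proof.
elim: r u => [|v r IH] u /=; first by rewrite addn0.
by move=> /andP[uv /IH ->]; move: uv; rewrite /qstep; lia.
Qed.

Lemma path_edges (E : {set LV n * LV n}) u r :
  path (fun v w => (v, w) \in E) u r = all [in E] (zip (u :: r) r).
Proof. by elim: r u => //= v r IH u; rewrite IH. Qed.

(** An edge is indexed by its direction and its target; the origin, which no edge enters, is added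
    by hand. *)
Definition ladder_graph H V : gsub n :=
  ([set v : LV n | [|| v == origin n, H v.1 v.2 | V v.1 v.2]],
   [set e : LV n * LV n |
      [&& e.2.1 == e.1.1.+1 :> nat, e.2.2 == e.1.2 :> nat & H e.2.1 e.2.2]
   || [&& e.2.1 == e.1.1 :> nat, e.2.2 == e.1.2.+1 :> nat & V e.2.1 e.2.2]]).

Lemma ladder_graph_qstep H V u v : (u, v) \in (ladder_graph H V).2 -> qstep n u v.
Proof. by rewrite inE /= /qstep; lia. Qed.

(** The [t]-th vertex of a positive path has coordinate sum [t], so its column alone determines
    it. *)
Definition path_col r t : nat := (nth (origin n) (origin n :: r) t).1.

Lemma mem_path_edges u v o r : reflect
  (exists2 t, t < size r &
     nth (origin n) (o :: r) t = u /\ nth (origin n) (o :: r) t.+1 = v)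
  ((u, v) \in zip (o :: r) r).
Proof.
elim: r o => [|w r IH] o /=; first by constructor => -[].
rewrite inE; apply: (iffP orP) => [[/eqP[-> ->]|/IH[t tr [e1 e2]]]|[[|t] tr [e1 e2]]].
- by exists 0.
- by exists t.+1.
- by left; rewrite -e1 -e2.
- by right; apply/IH; exists t.
Qed.

End StepGraphs.

(** * Terminal vertices and positive paths of the ladder diagram *)

Section LadderGraphs.

Variables (k : seq nat) (n : nat).
Hypothesis sum_k : sumn k = n.
Implicit Types (H V : nat -> nat -> bool) (u v : LV n) (r : seq (LV n)).

Definition is_level (m : nat) : bool :=
  m \in [seq nl k l | l <- iota 0 (size k).+1].

Lemma nl_le l : nl k l <= n.
Proof. by rewrite -sum_k -[in leqRHS](cat_take_drop l k) sumn_cat leq_addr. Qed.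

Lemma terminalE v : terminal k n v = (v.1 + v.2 == n) && is_level v.1.
Proof.
apply/hasP/andP => [[l lk /andP[/eqP v1 /eqP v2]]|[/eqP vn /mapP[l lk v1]]].
  split; first by rewrite v1 v2 subnKC ?nl_le.
  by apply/mapP; exists l.
by exists l => //; rewrite v1 eqxx -v1 /=; lia.
Qed.

Lemma is_level0 : is_level 0.
Proof. by apply/mapP; exists 0 => //; rewrite /nl take0. Qed.

Lemma is_leveln : is_level n.
Proof.
apply/mapP; exists (size k); first by rewrite mem_iota /=; lia.
by rewrite /nl take_size sum_k.
Qed.

(** The indices [0] and [size k] give only the levels [0] and [n]; the rest is the range in which
    the jumps of [lam] are indexed. *)
Lemma is_level_inner m : 0 < m < n ->
  is_level m = (m \in [seq nl k l | l <- iota 1 (size k).-1]).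
Proof.
move=> mn; apply/mapP/mapP => -[l]; rewrite mem_iota => lk ml; exists l => //.
  rewrite mem_iota; have l0 : l != 0.
    by apply/eqP => l0; move: ml; rewrite l0 /nl take0 /=; lia.
  have lk' : l != size k.
    by apply/eqP => l1; move: ml; rewrite l1 /nl take_size sum_k; lia.
  by lia.
by rewrite mem_iota; lia.
Qed.

Lemma terminal_inGamma v : terminal k n v -> inGamma k n v.
Proof.
by move=> /hasP[l lk /andP[/eqP v1 /eqP v2]]; apply/hasP; exists l; rewrite // v1 v2 !leqnn.
Qed.

Lemma inGamma_qstep u v : qstep n u v -> inGamma k n v -> inGamma k n u.
Proof.
move=> uv /hasP[l lk vl]; apply/hasP; exists l => //; move: uv vl.
by rewrite /qstep; lia.
Qed.

Lemma qstep_path_gstep u r :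
  path (qstep n) u r -> inGamma k n (last u r) -> path (gstep k n) u r && inGamma k n u.
Proof.
elim: r u => [|v r IH] u /=; first by move=> _ ->.
move=> /andP[uv vr] /(IH _ vr)/andP[-> vG].
by rewrite /gstep uv vG (inGamma_qstep _ _ uv vG).
Qed.

Lemma gstep_path_qstep u r : path (gstep k n) u r -> path (qstep n) u r.
Proof. by apply: sub_path => x y /and3P[]. Qed.

(** The ladder diagram is closed under predecessors, so a path that ends in a terminal vertex cannot
    have left it. *)
Lemma pos_pathE r : pos_path k n r =
  path (qstep n) (origin n) r && terminal k n (last (origin n) r).
Proof.
apply/andP/andP => -[p t]; split => //; first exact: gstep_path_qstep p.
by case/andP: (qstep_path_gstep _ _ p (terminal_inGamma _ t)).
Qed.

Lemma pos_path_size r : pos_path k n r -> size r = n.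
Proof.
rewrite pos_pathE terminalE => /andP[/qstep_path_level E /andP[/eqP en _]].
by move: en; rewrite E.
Qed.

(* [H a b] and [V a b] say whether the horizontal, resp. vertical, edge entering
   [(a, b)] is present; the flow conditions say that a vertex is entered
   iff it is left. *)
Record flow_pattern H V : Prop := FlowPattern {
  flow_hdom : forall a b, H a b -> (0 < a) && (a + b <= n);
  flow_vdom : forall a b, V a b -> (0 < b) && (a + b <= n);
  flow_haxis : forall a, 0 < a <= n -> H a 0;
  flow_vaxis : forall b, 0 < b <= n -> V 0 b;
  flow_inner : forall a b, 0 < a -> 0 < b -> a + b < n ->
    H a b || V a b = H a.+1 b || V a b.+1;
  flow_diag : forall a b, 0 < a -> 0 < b -> a + b = n -> H a b || V a b = is_level a
}.

(** * From flow patterns to faces of the ladder diagram *)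

Section FlowGraph.

Variables (H V : nat -> nat -> bool).
Hypothesis HV : flow_pattern H V.
Let g := ladder_graph n H V.
Let gedge : rel (LV n) := fun u v => (u, v) \in g.2.

Lemma flow_vertex v : v \in g.1 -> (v.1 + v.2 <= n) /\
  [\/ v = origin n,
      v.1 = 0 :> nat /\ 0 < v.2,
      v.2 = 0 :> nat /\ 0 < v.1
    | [/\ 0 < v.1, 0 < v.2 & H v.1 v.2 || V v.1 v.2]].
Proof.
move=> vg; split.
  move: vg; rewrite inE /= => /or3P[/eqP-> //|/(flow_hdom _ _ HV)|/(flow_vdom _ _ HV)]; lia.
case: v vg => a b /=; rewrite inE /=.
case: (posnP a) => a0; case: (posnP b) => b0.
- by move=> _; apply: Or41; congr (_, _); apply/val_inj.
- by move=> _; apply: Or42.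
- by move=> _; apply: Or43.
rewrite orbC => /orP[hv|/eqP[a0' _]]; last by move: a0; rewrite a0'.
by apply: Or44; split.
Qed.

(** On an axis the edge entering [u] is always present; at an inner vertex [flow_inner] turns the
    outgoing edge into an entering one. *)
Lemma flow_edge_source u v : gedge u v -> u \in g.1.
Proof.
rewrite /gedge !inE /= => uv; apply/negPn/negP => /norP[uo /norP[Hu Vu]].
have uo' : (0 < u.1) || (0 < u.2).
  apply: contraR uo => /norP[]; rewrite -!eqn0Ngt => /eqP u1 /eqP u2.
  by apply/eqP; case: u u1 u2 {uv Hu Vu} => a b /= a0 b0; congr (_, _); apply/val_inj.
have un : u.1 + u.2 < n.
  case/orP: uv => /and3P[/eqP e1 /eqP e2].
    by move/(flow_hdom _ _ HV); lia.
  by move/(flow_vdom _ _ HV); lia.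
case: (posnP u.1) => u1.
  by move: Vu; rewrite u1 (flow_vaxis _ _ HV) //; lia.
case: (posnP u.2) => u2.
  by move: Hu; rewrite u2 (flow_haxis _ _ HV) //; lia.
have := flow_inner _ _ HV _ _ u1 u2 un; rewrite (negbTE Hu) (negbTE Vu) /=.
case/orP: uv => /and3P[/eqP -> /eqP ->] ->; by rewrite ?orbT.
Qed.

Lemma flow_edge_target u v : gedge u v -> v \in g.1.
Proof. by rewrite /gedge !inE /= => /orP[]/and3P[_ _ ->]; rewrite ?orbT. Qed.

(** Walk backwards: a vertex other than the origin has an entering edge, whose source is one level
    lower and again in the graph. *)
Lemma flow_path_from_origin v : v \in g.1 ->
  exists2 r, path gedge (origin n) r & last (origin n) r = v.
Proof.
move: {-1}(v.1 + v.2) (erefl (v.1 + v.2)) => m.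
elim: m v => [|m IH] v vm vg.
  exists [::] => //=; case: v vm {vg} => a b /= ab.
  by rewrite /origin; congr (_, _); apply/val_inj => /=; lia.
have [u uv] : exists u, gedge u v.
  move: vg; rewrite inE => /or3P[/eqP vo|Hv|Vv].
  - by move: vm; rewrite vo.
  - have /andP[v1 vn] := flow_hdom _ _ HV _ _ Hv.
    have [||u u1 u2] := vertex_of_coords n v.1.-1 v.2; rewrite ?leq_ord //; first by lia.
    by exists u; rewrite /gedge inE /= Hv u1 u2; lia.
  - have /andP[v1 vn] := flow_vdom _ _ HV _ _ Vv.
    have [||u u1 u2] := vertex_of_coords n v.1 v.2.-1; rewrite ?leq_ord //; first by lia.
    by exists u; rewrite /gedge inE /= Vv u1 u2; lia.
have [||r pr lr] := IH u; last first.
- by exists (rcons r v); rewrite ?last_rcons // rcons_path pr lr.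
- exact: flow_edge_source uv.
- by have := ladder_graph_qstep _ _ _ _ _ uv; rewrite /qstep; lia.
Qed.

(** Induction on the distance to the antidiagonal: below it some edge leaves [v]; on it [v] is
    terminal, by [flow_diag] or as the end of an axis. *)
Lemma flow_path_to_terminal v : v \in g.1 ->
  exists2 r, path gedge v r & terminal k n (last v r).
Proof.
move: {-1}(n - (v.1 + v.2)) (erefl (n - (v.1 + v.2))) => m.
elim: m v => [|m IH] v vm vg; have [vn cases] := flow_vertex _ vg.
  exists [::] => //=; rewrite terminalE; apply/andP; split; first by lia.
  case: cases => [vo|[v1 v2]|[v2 v1]|[v1 v2 hv]].
  - by rewrite vo is_level0.
  - by rewrite v1 is_level0.
  - have -> : v.1 = n :> nat by lia.
    exact: is_leveln.
  - by rewrite -(flow_diag _ _ HV _ v.2) //; lia.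
have out : H v.1.+1 v.2 || V v.1 v.2.+1.
  case: cases => [vo|[v1 v2]|[v2 v1]|[v1 v2 hv]].
  - by rewrite vo (flow_haxis _ _ HV) //=; rewrite vo /= in vm; lia.
  - by rewrite v1 (flow_vaxis _ _ HV) ?orbT //; lia.
  - by rewrite v2 (flow_haxis _ _ HV) //; lia.
  - by rewrite -(flow_inner _ _ HV) //; lia.
have [w vw] : exists w, gedge v w.
  case/orP: out => h.
    have [||w w1 w2] := vertex_of_coords n v.1.+1 v.2; rewrite ?leq_ord //; first by lia.
    by exists w; rewrite /gedge inE /= w1 w2 h !eqxx.
  have [||w w1 w2] := vertex_of_coords n v.1 v.2.+1; rewrite ?leq_ord //; first by lia.
  by exists w; rewrite /gedge inE /= w1 w2 h !eqxx orbT.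
have [||r pr lr] := IH w; last first.
- by exists (w :: r) => //=; rewrite vw.
- exact: flow_edge_target vw.
- by have := ladder_graph_qstep _ _ _ _ _ vw; rewrite /qstep; lia.
Qed.

Lemma flow_paths_pos r :
  path gedge (origin n) r -> terminal k n (last (origin n) r) -> pos_path k n r.
Proof.
move=> pr tr; rewrite pos_pathE tr andbT; apply: sub_path pr.
exact: ladder_graph_qstep.
Qed.

Lemma flow_terminal v : terminal k n v -> v \in g.1.
Proof.
rewrite terminalE => /andP[/eqP vn lv]; rewrite inE /=.
case: (posnP v.1) => v1; case: (posnP v.2) => v2.
- apply/orP; left; apply/eqP; case: v v1 v2 {vn lv} => a b /= a0 b0.
  by congr (_, _); apply/val_inj.
- by rewrite v1 (flow_vaxis _ _ HV) ?orbT //; lia.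
- by rewrite v2 (flow_haxis _ _ HV) ?orbT //; lia.
- by rewrite (flow_diag _ _ HV) // lv orbT.
Qed.

Lemma flow_is_Gface : is_Gface k n g.
Proof.
split; first exact: flow_terminal.
(* Positive paths have length [n], so those inside [g] form a finite set of tuples; all of them are
   taken. *)
pose good := [pred t : n.-tuple (LV n) | path gedge (origin n) t &&
                                 terminal k n (last (origin n) t)].
have goodP r : path gedge (origin n) r -> terminal k n (last (origin n) r) ->
    r \in [seq val t | t <- enum good].
  move=> pr tr; have /eqP sr := pos_path_size _ (flow_paths_pos _ pr tr).
  by apply/mapP; exists (Tuple sr); rewrite // mem_enum inE /= pr tr.
have inv r : r \in [seq val t | t <- enum good] ->
    path gedge (origin n) r /\ terminal k n (last (origin n) r).
  by move=> /mapP[t]; rewrite mem_enum inE => /andP[pt tt] ->.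
exists [seq val t | t <- enum good]; split; [|split].
- by apply/allP => r /inv[]; exact: flow_paths_pos.
- apply/setP => v; rewrite [RHS]inE; apply/idP/hasP => [vg|[r /inv[pr _]]].
    have [r1 p1 l1] := flow_path_from_origin _ vg.
    have [r2 p2 t2] := flow_path_to_terminal _ vg.
    exists (r1 ++ r2); last by rewrite -cat_cons mem_cat -l1 mem_last.
    by apply: goodP; rewrite ?cat_path ?last_cat l1 ?p1.
  rewrite inE => /predU1P[->|]; first by rewrite inE eqxx.
  elim: r (origin n) pr => //= w r IH u /andP[uw wr].
  by rewrite inE => /predU1P[->|/(IH _ wr) //]; exact: flow_edge_target uw.
- apply/setP => -[u v]; rewrite [RHS]inE; apply/idP/hasP => [uv|[r /inv[pr _]]].
    have [r1 p1 l1] := flow_path_from_origin _ (flow_edge_source _ _ uv).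
    have [r2 p2 t2] := flow_path_to_terminal _ (flow_edge_target _ _ uv).
    exists (r1 ++ v :: r2).
      by apply: goodP; rewrite ?cat_path ?last_cat /= ?l1 ?p1 ?p2 ?andbT.
    elim: r1 (origin n) l1 {p1} => [|w r1 IH] o /= lo; first by rewrite lo inE eqxx.
    by rewrite inE IH ?orbT.
  by rewrite path_edges in pr; move/(allP pr).
Qed.

Lemma flow_ncomp : ncomp n g = 1.
Proof.
have csym : connect_sym (gadj n g).
  by apply: sym_connect_sym => u v; rewrite /gadj orbC.
rewrite /ncomp -(cards1 (fingraph.root (gadj n g) (origin n))); congr #|pred_of_set _|.
apply/setP => w; rewrite inE; apply/imsetP/eqP => [[v vg ->]|->]; last first.
  by exists (origin n); rewrite // inE eqxx.
apply/eqP; rewrite root_connect // csym; have [r pr lr] := flow_path_from_origin _ vg.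
apply/connectP; exists r => //; apply: sub_path pr => x y xy.
by apply/orP; left.
Qed.

Lemma flow_card_hedges :
  #|[set e : LV n * LV n | [&& e.2.1 == e.1.1.+1 :> nat, e.2.2 == e.1.2 :> nat
      & H e.2.1 e.2.2]]| = #|[set v : LV n | H v.1 v.2]|.
Proof.
set E := [set e | _]; have injE : {in E &, injective snd}.
  move=> [[a b] [c d]] [[a' b'] v]; rewrite !inE /=.
  move=> /and3P[/eqP e1 /eqP e2 _] /and3P[/eqP e3 /eqP e4 _] e5; subst v.
  by congr (_, _, _); apply/val_inj; rewrite /=; move: e1 e2 e3 e4 => /=; lia.
rewrite -(card_in_imset injE); congr #|pred_of_set _|; apply/setP => v.
rewrite inE; apply/imsetP/idP => [[e]|Hv]; first by rewrite inE => /and3P[_ _ He] ->.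
have /andP[v1 vn] := flow_hdom _ _ HV _ _ Hv.
have [||u u1 u2] := vertex_of_coords n v.1.-1 v.2;
  rewrite ?(leq_trans (leq_pred _) (leq_ord _)) ?leq_ord //.
by exists (u, v); rewrite // inE /= Hv u1 u2 ?prednK ?eqxx.
Qed.

Lemma flow_card_vedges :
  #|[set e : LV n * LV n | [&& e.2.1 == e.1.1 :> nat, e.2.2 == e.1.2.+1 :> nat
      & V e.2.1 e.2.2]]| = #|[set v : LV n | V v.1 v.2]|.
Proof.
set E := [set e | _]; have injE : {in E &, injective snd}.
  move=> [[a b] [c d]] [[a' b'] v]; rewrite !inE /=.
  move=> /and3P[/eqP e1 /eqP e2 _] /and3P[/eqP e3 /eqP e4 _] e5; subst v.
  by congr (_, _, _); apply/val_inj; rewrite /=; move: e1 e2 e3 e4 => /=; lia.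
rewrite -(card_in_imset injE); congr #|pred_of_set _|; apply/setP => v.
rewrite inE; apply/imsetP/idP => [[e]|Hv]; first by rewrite inE => /and3P[_ _ He] ->.
have /andP[v1 vn] := flow_vdom _ _ HV _ _ Hv.
have [||u u1 u2] := vertex_of_coords n v.1 v.2.-1;
  rewrite ?(leq_trans (leq_pred _) (leq_ord _)) ?leq_ord //.
by exists (u, v); rewrite // inE /= Hv u1 u2 ?prednK ?eqxx.
Qed.

(* Every vertex but the origin has in-degree 1 or 2, so the first Betti number
   counts the vertices of in-degree 2. *)
Lemma flow_gdim : gdim n g = #|[set v : LV n | H v.1 v.2 && V v.1 v.2]|.
Proof.
set TH := [set v : LV n | H v.1 v.2]; set TV := [set v : LV n | V v.1 v.2].
have -> : [set v : LV n | H v.1 v.2 && V v.1 v.2] = TH :&: TV.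
  by apply/setP => v; rewrite !inE.
have g1 : #|g.1| = (#|TH :|: TV|).+1.
  rewrite -[RHS]add1n (_ : g.1 = origin n |: (TH :|: TV)).
    rewrite cardsU1 !inE /=; congr (_ + _).
    have -> : H 0 0 = false by apply/negP => /(flow_hdom _ _ HV).
    by have -> : V 0 0 = false by apply/negP => /(flow_vdom _ _ HV).
  by apply/setP => v; rewrite !inE.
have g2 : #|g.2| = #|TH| + #|TV|.
  rewrite -flow_card_hedges -flow_card_vedges -cardsUI.
  rewrite [X in _ + X](_ : _ = 0) ?addn0; last first.
    by apply: eq_card0 => e; rewrite !inE; lia.
  by congr #|pred_of_set _|; apply/setP => e; rewrite !inE.
by rewrite /gdim flow_ncomp g1 g2 -cardsUI; lia.
Qed.

End FlowGraph.

(** * Positive paths in terms of their columns *)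

Section PathCoordinates.

Variable r : seq (LV n).
Hypothesis pr : pos_path k n r.
Let vtx t := nth (origin n) (origin n :: r) t.

Lemma pos_path_step t : t < n -> qstep n (vtx t) (vtx t.+1).
Proof.
move=> tn; move: (pr); rewrite pos_pathE => /andP[/(pathP (origin n)) H _].
by apply: H; rewrite (pos_path_size _ pr).
Qed.

Lemma pos_path_level t : t <= n -> (vtx t).1 + (vtx t).2 = t.
Proof.
by elim: t => // t IH tn; move: (IH (ltnW tn)) (pos_path_step _ tn); rewrite /qstep; lia.
Qed.

Lemma path_col_step t : t < n -> path_col n r t <= path_col n r t.+1 <= (path_col n r t).+1.
Proof. by move/pos_path_step; rewrite /qstep /path_col /vtx; lia. Qed.

Lemma path_col_mono s t : s <= t -> t <= n ->
  path_col n r s <= path_col n r t <= path_col n r s + (t - s).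
Proof.
move=> st; rewrite -(subnKC st); move: (t - s) => d {st}.
elim: d => [|d IH] dn; first by rewrite addn0; lia.
by have := IH ltac:(lia); have := path_col_step (s + d) ltac:(lia); rewrite addnS; lia.
Qed.

Lemma path_col_last : path_col n r n = (last (origin n) r).1.
Proof. by rewrite /path_col -[X in nth _ _ X](pos_path_size _ pr) (nth_last _ (_ :: r)). Qed.

Lemma path_col_level : is_level (path_col n r n).
Proof.
by rewrite path_col_last; move: pr; rewrite pos_pathE terminalE => /andP[_ /andP[]].
Qed.

(** A path meets level [t] only at time [t], which leaves a single position where the edge can
    occur. *)
Lemma mem_path_edges_col u v : qstep n u v -> u.1 + u.2 < n ->
  ((u, v) \in zip (origin n :: r) r) =
  (path_col n r (u.1 + u.2) == u.1) && (path_col n r (u.1 + u.2).+1 == v.1).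
Proof.
move=> uv un; apply/mem_path_edges/andP => [[t]|[/eqP e1 /eqP e2]].
  rewrite (pos_path_size _ pr) => tn [e1 e2].
  have := pos_path_level _ (ltnW tn); rewrite /vtx e1 => ->.
  by rewrite /path_col e1 e2.
exists (u.1 + u.2); first by rewrite (pos_path_size _ pr).
have := pos_path_level _ (ltnW un); have := pos_path_level _ un.
move: e1 e2; rewrite /path_col /vtx.
move: (nth _ _ _) => w; move: (nth _ _ _) => x; move: uv un.
case: u => a b; case: v => c d; case: w => a' b'; case: x => c' d'.
rewrite /qstep /= => uv un e1 e2 e3 e4.
by split; congr (_, _); apply/val_inj => /=; lia.
Qed.

End PathCoordinates.

End LadderGraphs.

Local Open Scope ring_scope.

(** * Extended coordinates and slacks as affine functions *)

Section Coordinates.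

Variables (R : realFieldType) (n : nat).
Implicit Types (lam : 'I_n -> R) (x y v : GCidx n -> R) (p : GCidx n).

Lemma GCidx_of_coords (i j : nat) : (0 < i)%N -> (0 < j)%N -> (i + j <= n)%N ->
  {p : GCidx n | (sval p).1 = i :> nat & (sval p).2 = j :> nat}.
Proof.
move=> i0 j0 ijn.
have hi : (i < n.+1)%N by lia.
have hj : (j < n.+1)%N by lia.
have h : GCidx_pred n (Ordinal hi, Ordinal hj) by rewrite /GCidx_pred /= i0 j0.
by exists (exist (fun z => is_true (GCidx_pred n z)) _ h).
Qed.

Lemma GCidx_inj p (q : GCidx n) : (sval p).1 = (sval q).1 :> nat -> (sval p).2 = (sval q).2 :> nat ->
  p = q.
Proof.
move=> e1 e2; apply/val_inj/eqP; rewrite -pair_eqE /pair_eq /=.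
by apply/andP; split; apply/eqP/val_inj.
Qed.

Lemma GCidx_bounds p :
  [/\ (0 < (sval p).1)%N, (0 < (sval p).2)%N & ((sval p).1 + (sval p).2 <= n)%N].
Proof. by case: p => p /= /and3P[]. Qed.

Lemma xe_coord lam x p : xe R n lam x (sval p).1 (sval p).2 = x p.
Proof.
rewrite /xe; case: pickP => [q /andP[/eqP e1 /eqP e2]|/(_ p)]; last by rewrite !eqxx.
by congr (x _); apply: GCidx_inj.
Qed.

Lemma xe_diag lam x i j : (i + j)%N = n.+1 -> xe R n lam x i j = lamat R n lam i.
Proof.
move=> ij; rewrite /xe ij eqxx; case: pickP => // p /andP[/eqP e1 /eqP e2].
by have [_ _] := GCidx_bounds p; rewrite e1 e2 ij ltnn.
Qed.

Lemma lamat0 i : lamat R n (fun=> 0) i = 0.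
Proof. by case: i => //= i; case: insub. Qed.

(** A displacement [v] is extended by zero to the antidiagonal, where the values of [lam] stay
    fixed. *)
Lemma xe_perturb lam x (e : R) v i j :
  xe R n lam (fun p => x p + e * v p) i j =
  xe R n lam x i j + e * xe R n (fun=> 0) v i j.
Proof.
by rewrite /xe; case: pickP => // _; rewrite lamat0 if_same mulr0 addr0.
Qed.

Lemma xe_sub lam x y i j :
  xe R n (fun=> 0) (fun p => x p - y p) i j = xe R n lam x i j - xe R n lam y i j.
Proof.
by rewrite /xe; case: pickP => // _; rewrite lamat0 if_same subrr.
Qed.

Lemma xe_expand lam x i j : xe R n lam x i j = xe R n lam (fun=> 0) i j +
  \sum_p x p * (((sval p).1 == i :> nat) && ((sval p).2 == j :> nat))%:R.
Proof.
rewrite /xe; case: pickP => [p /andP[/eqP e1 /eqP e2]|no].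
  rewrite (bigD1 p) //= e1 e2 !eqxx mulr1 big1 ?addr0 ?add0r // => q qp.
  case: andP => [[/eqP f1 /eqP f2]|]; last by rewrite mulr0.
  by case/eqP: qp; apply: GCidx_inj; rewrite ?e1 ?e2.
by rewrite big1 ?addr0 // => p _; rewrite no mulr0.
Qed.

(* The two defining inequalities of the polytope at the index [q.1]: the one
   with the box above ([q.2 = true]) and the one with the box to the right. *)
Definition slack lam x (q : GCidx n * bool) : R :=
  let X := xe R n lam x in let i := (sval q.1).1 in let j := (sval q.1).2 in
  if q.2 then X i j.+1 - X i j else X i j - X i.+1 j.

Lemma inGC_slack lam x : inGC R n lam x <-> forall q, 0 <= slack lam x q.
Proof.
split=> [Px [p []]|Px p]; rewrite /slack /= ?subr_ge0; try by case: (Px p).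
by split; rewrite -subr_ge0; [exact: (Px (p, true))|exact: (Px (p, false))].
Qed.

Lemma slack_perturb lam x (e : R) v q :
  slack lam (fun p => x p + e * v p) q = slack lam x q + e * slack (fun=> 0) v q.
Proof. by rewrite /slack /=; case: q => p []; rewrite !xe_perturb /=; ring. Qed.

Lemma slack_sub lam x y q :
  slack (fun=> 0) (fun p => x p - y p) q = slack lam x q - slack lam y q.
Proof. by rewrite /slack /=; case: q => p []; rewrite !(xe_sub lam) /=; ring. Qed.

(** This is the linear part of [slack]: boxes on the antidiagonal match no index and enter only the
    constant term. *)
Definition slack_coef (q : GCidx n * bool) p : R :=
  let d i j : R := (((sval p).1 == i :> nat) && ((sval p).2 == j :> nat))%:R in
  let i : nat := (sval q.1).1 in let j : nat := (sval q.1).2 in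
  if q.2 then d i j.+1 - d i j else d i j - d i.+1 j.

Lemma slack_expand lam x q :
  slack lam x q = slack lam (fun=> 0) q + \sum_p x p * slack_coef q p.
Proof.
rewrite /slack /slack_coef /=; case: q => q [] /=.
  rewrite [X in X - _ = _]xe_expand [X in _ - X = _]xe_expand.
  by under [in RHS]eq_bigr => p _ do rewrite mulrBr; rewrite sumrB; ring.
rewrite [X in X - _ = _]xe_expand [X in _ - X = _]xe_expand.
by under [in RHS]eq_bigr => p _ do rewrite mulrBr; rewrite sumrB; ring.
Qed.

End Coordinates.

(** * Faces as sets of points with prescribed tight inequalities *)

Section Faces.

Variables (R : realFieldType) (n : nat) (lam : 'I_n -> R).
Implicit Types (x y v : GCidx n -> R).

(** For [x] in the polytope, the points [y] of the polytope with this property form the smallest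
    face containing [x]. *)
Definition tight_le y x := forall q, slack R n lam x q = 0 -> slack R n lam y q = 0.

Lemma small_step (I : finType) (s d : I -> R) :
  (forall i, 0 <= s i) -> (forall i, s i = 0 -> d i = 0) ->
  exists2 e, 0 < e & forall i, 0 <= s i + e * d i.
Proof.
(* [N] dominates every ratio of [|d i|] to [s i], so a step of length [1/N] works; the summand [1]
   makes [N] positive. *)
move=> s0 sd; pose N := 1 + \sum_i `|d i| / s i.
have sum0 (P : pred I) : 0 <= \sum_(i | P i) `|d i| / s i.
  by apply: sumr_ge0 => i _; rewrite divr_ge0.
have N0 : 0 < N by rewrite ltr_pwDl.
exists N^-1 => [|i]; first by rewrite invr_gt0.
have [si|si] := eqVneq (s i) 0; first by rewrite sd // si mulr0 addr0.
have si0 : 0 < s i by rewrite lt_neqAle eq_sym si s0.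
have : `|d i| / s i <= N.
  by rewrite /N (bigD1 i) //= addrCA lerDl addr_ge0.
rewrite ler_pdivrMr // => dN; rewrite -(pmulr_rge0 _ N0) mulrDr mulrA divff ?gt_eqF // mul1r.
by rewrite -lerBlDr sub0r (le_trans (ler_norm _)) // normrN.
Qed.

Lemma inGC_perturb x v : inGC R n lam x ->
  (forall q, slack R n lam x q = 0 -> slack R n (fun=> 0) v q = 0) ->
  exists2 e, 0 < e &
    inGC R n lam (fun p => x p + e * v p) /\ tight_le (fun p => x p + e * v p) x.
Proof.
move=> /inGC_slack Px xv; have [e e0 he] := small_step _ _ _ Px xv.
exists e => //; split; first by apply/inGC_slack => q; rewrite slack_perturb.
by move=> q xq; rewrite slack_perturb xq (xv q xq) mulr0 addr0.
Qed.

(** Take a point of [F] with the largest number of strict inequalities: its midpoint with a [y]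
    violating the claim would have more. *)
Lemma generic_point (F : (GCidx n -> R) -> Prop) : is_Pface R n lam F ->
  exists2 x, F x & forall y, F y -> tight_le y x.
Proof.
move=> [[x1 Fx1] [c Fc]].
pose supp x := [set q | slack R n lam x q != 0].
pose P m := `[< exists2 x, F x & #|supp x| = m >].
have exP : exists m, P m by exists #|supp x1|; apply/asboolP; exists x1.
have ubP m : P m -> (m <= #|{: GCidx n * bool}|)%N.
  by move=> /asboolP[x _ <-]; exact: max_card.
case: (ex_maxnP exP ubP) => m /asboolP[x Fx xm] mmax.
exists x => // y Fy q xq; apply/eqP/negPn/negP => yq.
pose z p := x p + 2^-1 * (y p - x p).
have zE q' : slack R n lam z q' = (slack R n lam x q' + slack R n lam y q') / 2.
  by rewrite slack_perturb (slack_sub _ _ lam); field.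
have /Fc[Px maxx] := Fx; have /Fc[Py maxy] := Fy.
have Fz : F z.
  apply/Fc; split.
    apply/inGC_slack => q'; rewrite zE divr_ge0 // addr_ge0 //.
      exact: (iffLR (inGC_slack _ _ _ _) Px).
    exact: (iffLR (inGC_slack _ _ _ _) Py).
  move=> t Pt; have -> : \sum_p c p * z p =
      2^-1 * (\sum_p c p * x p) + 2^-1 * (\sum_p c p * y p).
    by rewrite !mulr_sumr -big_split; apply: eq_bigr => p _; rewrite /z /=; field.
  by have := maxx _ Pt; have := maxy _ Pt; lra.
have lt : (#|supp x| < #|supp z|)%N.
  apply: proper_card; apply/properP; split.
    apply/subsetP => q'; rewrite !inE zE => xq'.
    have xq0 := iffLR (inGC_slack _ _ _ _) Px q'.
    have yq0 := iffLR (inGC_slack _ _ _ _) Py q'.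
    by apply: lt0r_neq0; rewrite divr_gt0 // ltr_pwDl // lt_neqAle eq_sym xq' xq0.
  exists q; rewrite !inE ?xq ?eqxx // zE xq add0r.
  by rewrite mulf_eq0 invr_eq0 pnatr_eq0 orbF.
have : P #|supp z| by apply/asboolP; exists z.
by move/mmax; rewrite -xm leqNgt lt.
Qed.

Lemma Pface_generic (F : (GCidx n -> R) -> Prop) : is_Pface R n lam F ->
  exists2 x, F x & forall y, F y <-> inGC R n lam y /\ tight_le y x.
Proof.
move=> FP; have [x Fx xgen] := generic_point _ FP; exists x => // y.
have [_ [c Fc]] := FP; have /Fc[Px maxx] := Fx.
split=> [Fy|[Py yx]]; first by split; [case/Fc: Fy|exact: xgen].
(* Moving from [x] slightly away from [y] stays in the polytope, so the
   functional cannot be smaller at [y] than at [x]. *)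
have [|e e0 [Pe _]] := inGC_perturb x (fun p => x p - y p) Px.
  by move=> q xq; rewrite (slack_sub _ _ lam) xq (yx q xq) subrr.
have := maxx _ Pe.
have -> : \sum_p c p * (x p + e * (x p - y p)) =
    \sum_p c p * x p + e * (\sum_p c p * x p - \sum_p c p * y p).
  rewrite mulrBr !mulr_sumr -sumrB -big_split.
  by apply: eq_bigr => p _ /=; ring.
rewrite gerDl pmulr_rle0 // subr_le0 => xy.
by apply/Fc; split=> // t /maxx tx; exact: le_trans tx xy.
Qed.

(** Up to a constant, the functional is minus the sum of the slacks tight at [x]. That sum is
    nonnegative on the polytope and zero at [x], so the maximizers are the points where each of
    these slacks vanishes. *)
Lemma tight_is_Pface x : inGC R n lam x ->
  is_Pface R n lam (fun y => inGC R n lam y /\ tight_le y x).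
Proof.
move=> Px; split; first by exists x; split.
pose T := [pred q | slack R n lam x q == 0].
exists (fun p => - \sum_(q | T q) slack_coef R n q p) => y.
pose L z := \sum_(q | T q) slack R n lam z q.
have LE z : \sum_p (- \sum_(q | T q) slack_coef R n q p) * z p = L (fun=> 0) - L z.
  rewrite /L -sumrB [RHS](eq_bigr (fun q => - \sum_p z p * slack_coef R n q p)) => [|q _].
    rewrite sumrN exchange_big /= -sumrN; apply: eq_bigr => p _.
    by rewrite mulNr mulr_suml; congr (- _); apply: eq_bigr => q _; rewrite mulrC.
  by rewrite [slack R n lam z q]slack_expand; ring.
have L0 z : inGC R n lam z -> 0 <= L z.
  by move=> /inGC_slack Pz; apply: sumr_ge0 => q _.
split=> -[Py hy]; split=> //.
  move=> z Pz; rewrite !LE lerD2l lerN2 (_ : L y = 0) ?L0 //.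
  by apply: big1 => q /eqP; exact: hy.
have := hy x Px; rewrite !LE lerD2l lerN2 (_ : L x = 0); last by apply: big1 => q /eqP.
move=> Ly q xq; have : L y == 0 by rewrite eq_le Ly L0.
rewrite psumr_eq0 => [|q' _]; last by move/inGC_slack: Py; apply.
by move=> /allP/(_ q); rewrite mem_index_enum => /(_ isT)/implyP/(_ _)/eqP-> //; apply/eqP.
Qed.

End Faces.

(** * Extending values from the boxes at vertices of in-degree 2 *)

Section FlowExtension.

Variables (R : realFieldType) (k : seq nat) (n : nat) (H V : nat -> nat -> bool).
Hypothesis HV : flow_pattern k n H V.

(** The fuel [d] is the distance to the antidiagonal, where the value is [0]. A box with a missing
    edge copies its neighbour: the right one if the top edge is present, the upper one otherwise. *)
Fixpoint flow_ext_rec (f : nat -> nat -> R) (d a b : nat) : R :=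
  if d is d'.+1 then
    if H a b && V a b then f a b
    else if H a b then flow_ext_rec f d' a.+1 b else flow_ext_rec f d' a b.+1
  else 0.

(* A function constant across the missing edges and vanishing on the diagonal
   can be prescribed freely on the boxes whose upper right corner has
   in-degree 2. *)
Lemma flow_ext (f : nat -> nat -> R) : exists U : nat -> nat -> R,
  (forall a b, (a + b)%N = n.+1 -> U a b = 0) /\
  (forall a b, (0 < a)%N -> (0 < b)%N -> (a + b <= n)%N ->
    [/\ H a b && V a b -> U a b = f a b,
        ~~ H a b -> U a b = U a b.+1
      & ~~ V a b -> U a b = U a.+1 b]).
Proof.
pose U a b := flow_ext_rec f (n.+1 - (a + b)) a b.
have U0 a b : (a + b)%N = n.+1 -> U a b = 0 by rewrite /U => ->; rewrite subnn.
have US a b : (a + b <= n)%N -> U a b =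
    if H a b && V a b then f a b else if H a b then U a.+1 b else U a b.+1.
  by move=> abn; rewrite /U subSn //= addSn addnS subSS.
have UH a b : (a + b <= n)%N -> ~~ H a b -> U a b = U a b.+1.
  by move=> abn Hab; rewrite US // (negbTE Hab).
exists U; split=> // a b; move: {-1}(n - (a + b))%N (erefl (n - (a + b))%N) => d.
elim/ltn_ind: d a b => d IH a b dE a0 b0 abn; split; last first.
- move=> Vab; rewrite US // (negbTE Vab) andbF; case: ifPn => // Hab.
  have [abn'|abn'] := eqVneq (a + b)%N n; first by rewrite !U0 // ?addnS ?addSn abn'.
  have abl : (a + b < n)%N by rewrite ltn_neqAle abn' abn.
  have := flow_inner _ _ _ _ HV _ _ a0 b0 abl; rewrite (negbTE Hab) (negbTE Vab) /=.
  (* Both edges entering the vertex are missing, hence both edges leaving it as well, and the value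
     is carried around the vertex through the box [(a+1, b+1)]. *)
  move=> /esym/negbT/norP[H1 V1].
  rewrite (UH a.+1 b) //.
  by have [_ _ ->] := IH (n - (a + b.+1))%N ltac:(lia) a b.+1 erefl a0 isT ltac:(lia).
- exact: UH.
- by rewrite US // => ->.
Qed.

End FlowExtension.

(** * Strict inequalities of a point as a pattern of edges *)

Lemma lt_chain (R : realFieldType) (x y z : R) :
  x <= y -> y <= z -> (x < y) || (y < z) = (x < z).
Proof.
move=> xy yz; apply/orP/idP => [[|] h|h]; [exact: lt_le_trans h yz|exact: le_lt_trans xy h|].
by case: (ltP x y) => yx; [left|right; exact: le_lt_trans yx h].
Qed.

Section StrictPattern.

Variables (R : realFieldType) (n : nat) (lam : 'I_n -> R).
Implicit Types (x y v : GCidx n -> R).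
Notation Xe x := (xe R n lam x).

(** No box lies below the axis [b = 0]; its edges are declared present, since every face of the
    ladder diagram contains them. *)
Definition hstrict x (a b : nat) : bool :=
  [&& (0 < a)%N, (a + b <= n)%N & (b == 0%N) || (Xe x a b < Xe x a b.+1)].

Definition vstrict x (a b : nat) : bool :=
  [&& (0 < b)%N, (a + b <= n)%N & (a == 0%N) || (Xe x a.+1 b < Xe x a b)].

Lemma hstrict_slack x (p : GCidx n) :
  hstrict x (sval p).1 (sval p).2 = (0 < slack R n lam x (p, true)).
Proof.
have [p1 p2 pn] := GCidx_bounds n p.
by rewrite /hstrict p1 pn gtn_eqF //= /slack /= subr_gt0.
Qed.

Lemma vstrict_slack x (p : GCidx n) :
  vstrict x (sval p).1 (sval p).2 = (0 < slack R n lam x (p, false)).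
Proof.
have [p1 p2 pn] := GCidx_bounds n p.
by rewrite /vstrict p2 pn gtn_eqF //= /slack /= subr_gt0.
Qed.

Lemma inGC_coords x : inGC R n lam x -> forall a b, (0 < a)%N -> (0 < b)%N ->
  (a + b <= n)%N -> Xe x a b <= Xe x a b.+1 /\ Xe x a.+1 b <= Xe x a b.
Proof.
by move=> Px a b a0 b0 abn; have [p <- <-] := GCidx_of_coords n a b a0 b0 abn; exact: Px.
Qed.

Lemma tight_le_strict y x : inGC R n lam x -> inGC R n lam y ->
  tight_le R n lam y x <-> (forall a b, hstrict y a b -> hstrict x a b) /\
                      (forall a b, vstrict y a b -> vstrict x a b).
Proof.
move=> /inGC_slack Px /inGC_slack Py; split=> [yx|[yxH yxV] [p c] xq].
  have lt q : 0 < slack R n lam y q -> 0 < slack R n lam x q.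
    move=> yq; rewrite lt_neqAle Px andbT eq_sym.
    by apply/eqP => /yx yq0; rewrite yq0 ltxx in yq.
  split=> a b ab.
    case: (posnP b) => b0; first by move: ab; rewrite /hstrict b0.
    have /and3P[a0 abn _] := ab; have [p e1 e2] := GCidx_of_coords n a b a0 b0 abn.
    by move: ab; rewrite -e1 -e2 !hstrict_slack; exact: lt.
  case: (posnP a) => a0; first by move: ab; rewrite /vstrict a0.
  have /and3P[b0 abn _] := ab; have [p e1 e2] := GCidx_of_coords n a b a0 b0 abn.
  by move: ab; rewrite -e1 -e2 !vstrict_slack; exact: lt.
apply/eqP; rewrite eq_le Py andbT leNgt; apply/negP => yq.
case: c xq yq => xq; rewrite -?hstrict_slack -?vstrict_slack.
  by move=> /yxH; rewrite hstrict_slack xq ltxx.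
by move=> /yxV; rewrite vstrict_slack xq ltxx.
Qed.

Lemma xe_of_fun (mu : 'I_n -> R) (U : nat -> nat -> R) :
  (forall a b, (0 < a)%N -> (0 < b)%N -> (a + b)%N = n.+1 -> U a b = lamat R n mu a) ->
  forall a b, (0 < a)%N -> (0 < b)%N -> (a + b <= n.+1)%N ->
  xe R n mu (fun p => U (sval p).1 (sval p).2) a b = U a b.
Proof.
move=> Ud a b a0 b0; rewrite leq_eqVlt ltnS => /orP[/eqP ab|ab].
  by rewrite xe_diag // Ud.
by have [p <- <-] := GCidx_of_coords n a b a0 b0 ab; rewrite xe_coord.
Qed.

Definition free_boxes x : {set GCidx n} :=
  [set p : GCidx n | hstrict x (sval p).1 (sval p).2 && vstrict x (sval p).1 (sval p).2].

(** On the smallest face of [x], a box that is not free agrees with the box above or to the right,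
    so an affine relation between the free coordinates propagates from the antidiagonal to all
    boxes. *)
Lemma tight_aff_dep x m (pts : 'I_m -> (GCidx n -> R)) : inGC R n lam x ->
  (forall i, inGC R n lam (pts i) /\ tight_le R n lam (pts i) x) ->
  (#|free_boxes x|.+1 < m)%N -> ~ aff_indep R n m pts.
Proof.
move=> Px Fpts; set d := #|_| => dm indep.
(* The column of ones forces the coefficients of a relation to add up to [0]; the other columns are
   the free coordinates. There are more rows than columns. *)
pose M : 'M[R]_(m, d.+1) :=
  \matrix_(i, j) oapp (fun l => pts i (enum_val (A := mem (free_boxes x)) l)) 1 (unlift ord0 j).
have : kermx M != 0.
  by rewrite kermx_eq0 /row_free neq_ltn (leq_ltn_trans (rank_leq_col M) dm).
case/rowV0Pn => c /sub_kermxP cM c0; case/eqP: c0; apply/rowP => i; rewrite mxE.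
have cME j : \sum_l c 0 l * M l j = 0.
  by have /rowP/(_ j) := cM; rewrite !mxE.
have csum : \sum_l c 0 l = 0.
  rewrite -[RHS](cME ord0); apply: eq_bigr => l _.
  by rewrite mxE unlift_none mulr1.
apply: (indep (fun l => c 0 l)) => //.
suff cX a b : (0 < a)%N -> (0 < b)%N -> (a + b <= n.+1)%N ->
    \sum_l c 0 l * Xe (pts l) a b = 0.
  move=> p; have [p1 p2 pn] := GCidx_bounds n p.
  rewrite -[RHS](cX _ _ p1 p2 (leqW pn)); apply: eq_bigr => l _.
  by rewrite xe_coord.
move: {-1}(n.+1 - (a + b))%N (erefl (n.+1 - (a + b))%N) => t.
elim: t a b => [|t IH] a b tE a0 b0 abn.
  rewrite (eq_bigr (fun l => c 0 l * lamat R n lam a)) => [|l _].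
    by rewrite -mulr_suml csum mul0r.
  by rewrite xe_diag //; lia.
have abn' : (a + b <= n)%N by lia.
have [p e1 e2] := GCidx_of_coords n a b a0 b0 abn'.
case Sp : (p \in free_boxes x).
  rewrite -[RHS](cME (lift ord0 (enum_rank_in Sp p))); apply: eq_bigr => l _.
  by rewrite mxE liftK /= enum_rankK_in // -(xe_coord R n lam) e1 e2.
move: Sp; rewrite inE => /nandP[].
  rewrite hstrict_slack -leNgt => xq; rewrite -[RHS](IH a b.+1) //; [|lia|lia].
  have tq : slack R n lam x (p, true) = 0.
    by apply/eqP; rewrite eq_le xq; move/inGC_slack: Px; apply.
  apply: eq_bigr => l _; have [_ /(_ _ tq)] := Fpts l.
  by rewrite /slack /= e1 e2 => /eqP; rewrite subr_eq0 => /eqP->.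
rewrite vstrict_slack -leNgt => xq; rewrite -[RHS](IH a.+1 b) //; [|lia].
have tq : slack R n lam x (p, false) = 0.
  by apply/eqP; rewrite eq_le xq; move/inGC_slack: Px; apply.
apply: eq_bigr => l _; have [_ /(_ _ tq)] := Fpts l.
by rewrite /slack /= e1 e2 => /eqP; rewrite subr_eq0 => /eqP->.
Qed.

End StrictPattern.

(** * Points of the polytope give flow patterns; independent points in a face *)

Section InteriorPattern.

Variables (R : realFieldType) (k : seq nat) (n : nat) (lam : 'I_n -> R).
Hypothesis sum_k : sumn k = n.
Hypothesis lam_step : forall i j : 'I_n, val j = (val i).+1 ->
  if (val i).+1 \in [seq nl k l | l <- iota 1 (size k).-1]
  then lam j < lam i else lam j == lam i.
Implicit Types (x y v : GCidx n -> R).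
Notation Xe x := (xe R n lam x).
Notation hstrict := (hstrict R n lam).
Notation vstrict := (vstrict R n lam).
Notation free_boxes := (free_boxes R n lam).

Lemma lamat_step a : (0 < a < n)%N ->
  lamat R n lam a.+1 <= lamat R n lam a /\
  (lamat R n lam a.+1 < lamat R n lam a) = is_level k a.
Proof.
move=> /andP[a0 an]; have an' : (a.-1 < n)%N by lia.
(* [lam] is 0-based, so the two values sit at the indices [a] and [a - 1]. *)
have -> : lamat R n lam a.+1 = lam (Ordinal an).
  by rewrite /lamat insubT.
have -> : lamat R n lam a = lam (Ordinal an').
  by rewrite -[in LHS](prednK a0) /lamat insubT.
have := lam_step (Ordinal an') (Ordinal an).
rewrite /= prednK // => /(_ erefl); rewrite -(is_level_inner _ _ sum_k) ?a0 //.
by case: (is_level k a) => [lt|/eqP->]; rewrite ?(ltW lt) ?lt ?ltxx.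
Qed.

Lemma inGC_flow_pattern x : inGC R n lam x -> flow_pattern k n (hstrict x) (vstrict x).
Proof.
move=> Px; have P := inGC_coords _ _ _ _ Px; split.
- by move=> a b /and3P[-> ->].
- by move=> a b /and3P[-> ->].
- by move=> a /andP[a0 an]; rewrite /hstrict a0 addn0 an.
- by move=> a /andP[a0 an]; rewrite /vstrict a0 an.
- move=> a b a0 b0 abn; have abn' := ltnW abn.
  rewrite /hstrict /vstrict !addnS !addSn a0 b0 abn abn' !gtn_eqF //=.
  (* The chains from [(a+1, b)] to [(a, b+1)] through [(a, b)] and through [(a+1, b+1)] have the
     same ends, so one has a strict step iff the other has. *)
  have [h1 h2] := P a b a0 b0 abn'.
  have [|h3 _] := P a.+1 b isT b0; first by rewrite addSn.
  have [|_ h4] := P a b.+1 a0 isT; first by rewrite addnS.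
  by rewrite orbC !lt_chain.
- move=> a b a0 b0 abn; rewrite /hstrict /vstrict a0 b0 abn leqnn !gtn_eqF //=.
  (* Here the ends of the chain are [lambda_(a+1)] and [lambda_a], which differ iff [a] is a
     level. *)
  have [h1 h2] := P a b a0 b0 ltac:(lia).
  have [|_ <-] := lamat_step a; first by lia.
  rewrite -(xe_diag R n lam x a b.+1) ?addnS ?abn //.
  rewrite -(xe_diag R n lam x a.+1 b) ?addSn ?abn //.
  by rewrite orbC lt_chain.
Qed.

Lemma gdim_free_boxes x : inGC R n lam x ->
  gdim n (ladder_graph n (hstrict x) (vstrict x)) = #|free_boxes x|.
Proof.
move=> Px; rewrite (flow_gdim _ _ sum_k _ _ (inGC_flow_pattern _ Px)).
rewrite -(card_imset _ (@val_inj _ _ (GCidx n))); congr #|pred_of_set _|.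
apply/setP => v; rewrite inE; apply/idP/imsetP => [hv|[p + ->]]; last by rewrite inE.
have /andP[/and3P[v1 vn _] /and3P[v2 _ _]] := hv.
have [p e1 e2] := GCidx_of_coords n v.1 v.2 v1 v2 vn.
exists p; first by rewrite inE e1 e2.
by rewrite [LHS]surjective_pairing [RHS]surjective_pairing; congr (_, _); apply/val_inj.
Qed.

(** The points are [x] and one small displacement of [x] for each free box, along directions dual to
    the free coordinates. *)
Lemma tight_aff_indep x : inGC R n lam x ->
  exists pts : 'I_(#|free_boxes x|).+1 -> (GCidx n -> R),
    (forall i, inGC R n lam (pts i) /\ tight_le R n lam (pts i) x) /\ aff_indep R n _ pts.
Proof.
move=> Px; set d := #|_|.
have dir (i : 'I_d) : exists v : GCidx n -> R,
    (forall q, slack R n lam x q = 0 -> slack R n (fun=> 0) v q = 0) /\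
    (forall j : 'I_d, v (enum_val j) = (i == j)%:R).
  (* The value is [1] on the [i]-th free box and [0] on the others; [flow_ext] fills the remaining
     boxes so that tight inequalities stay tight. *)
  pose f a b : R := (((sval (enum_val i)).1 == a :> nat) && ((sval (enum_val i)).2 == b :> nat))%:R.
  have [U [U0 UE]] := flow_ext R k n _ _ (inGC_flow_pattern _ Px) f.
  have UX : forall a b, (0 < a)%N -> (0 < b)%N -> (a + b <= n.+1)%N ->
      xe R n (fun=> 0) (fun p => U (sval p).1 (sval p).2) a b = U a b.
    by apply: xe_of_fun => a b _ _ ab; rewrite lamat0 U0.
  exists (fun p : GCidx n => U (sval p).1 (sval p).2); split=> [[p c] xq|j].
    have [p1 p2 pn] := GCidx_bounds n p; have [_ UH UV] := UE _ _ p1 p2 pn.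
    rewrite /slack /=; case: c xq => xq; rewrite !UX // ?addnS ?addSn ?(leqW pn) //.
      by rewrite UH ?subrr // hstrict_slack xq ltxx.
    by rewrite UV ?subrr // vstrict_slack xq ltxx.
  have [p1 p2 pn] := GCidx_bounds n (enum_val j).
  have [Uf _ _] := UE _ _ p1 p2 pn.
  rewrite Uf; last by have := enum_valP j; rewrite inE.
  rewrite /f; congr (_%:R); congr nat_of_bool; apply/andP/eqP => [[/eqP e1 /eqP e2]|->] //.
  by apply: enum_val_inj; apply: GCidx_inj.
have [v vP] := fin_all_exists dir.
have steps (i : 'I_d) : exists t, 0 < t /\
    (inGC R n lam (fun p => x p + t * v i p) /\
     tight_le R n lam (fun p => x p + t * v i p) x).
  by have [t t0 tP] := inGC_perturb R n lam x (v i) Px (proj1 (vP i)); exists t.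
have [e eP] := fin_all_exists steps.
exists (fun i => oapp (fun j p => x p + e j * v j p) x (unlift ord0 i)); split.
  by move=> i; case: unliftP => [j _|_] /=; [case: (eP j)|split].
move=> c; rewrite big_ord_recl => c0 cp.
(* The coefficients add up to [0], so the base point [x] cancels; evaluating at a free box then
   isolates one coefficient. *)
have cx p : \sum_(j < d) c (lift ord0 j) * (e j * v j p) = 0.
  rewrite -[RHS](cp p) big_ord_recl unlift_none /=.
  under [X in _ = _ + X]eq_bigr => j _ do rewrite liftK /= mulrDr.
  by rewrite big_split /= addrA -mulr_suml -mulrDl c0 mul0r add0r.
have cl (j : 'I_d) : c (lift ord0 j) = 0.
  have := cx (enum_val j); rewrite (bigD1 j) //= big1 ?addr0 => [|i ij].
    have [_ ->] := vP j; rewrite eqxx mulr1 => /eqP.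
    by rewrite mulf_eq0 [e j == 0]gt_eqF ?orbF => [/eqP|]; last by case: (eP j).
  by have [_ ->] := vP i; rewrite (negbTE ij) !mulr0.
move=> i; case: (unliftP ord0 i) => [j ->|->]; first exact: cl.
by move: c0; rewrite big1 ?addr0 // => j _; exact: cl.
Qed.

End InteriorPattern.

(** * Weighted paths: a point of the polytope for each face of the diagram *)

Lemma mem_path_target n (o v : LV n) r :
  v \in r <-> exists u, (u, v) \in zip (o :: r) r.
Proof.
elim: r o => [|w r IH] o; first by split=> // -[].
rewrite inE; split=> [/predU1P[->|/(IH w)[u ur]]|[u]].
- by exists o; rewrite /= inE eqxx.
- by exists u; rewrite /= inE ur orbT.
- rewrite /= inE => /predU1P[[_ ->]|ur]; first by rewrite eqxx.
  by apply/orP; right; apply/(IH w); exists u.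
Qed.

Section FaceToPoint.

Variables (R : realFieldType) (k : seq nat) (n : nat) (lam : 'I_n -> R).
Hypothesis sum_k : sumn k = n.
Hypothesis lam_step : forall i j : 'I_n, val j = (val i).+1 ->
  if (val i).+1 \in [seq nl k l | l <- iota 1 (size k).-1]
  then lam j < lam i else lam j == lam i.
Variables (g : gsub n) (ps : seq (seq (LV n))).
Hypothesis g_terminal : forall v, terminal k n v -> v \in g.1.
Hypothesis ps_pos : all (pos_path k n) ps.
Hypothesis g_vertices : g.1 = [set v | has (fun r => v \in origin n :: r) ps].
Hypothesis g_edges : g.2 = [set e | has (fun r => e \in zip (origin n :: r) r) ps].

Let pos r : r \in ps -> pos_path k n r. Proof. exact: (allP ps_pos). Qed.
Let L := lamat R n lam.
Let col := path_col n.
Let endcol r : 'I_n.+1 := (last (origin n) r).1.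
Let colE r : r \in ps -> col r n = endcol r.
Proof. by move/pos/(path_col_last _ _ sum_k). Qed.

(** The guard keeps the default values of [lamat] at [0] and [n+1] out of the jumps. *)
Let gap (c : nat) : R := if (0 < c < n)%N then L c - L c.+1 else 0.
Let mult (c : 'I_n.+1) : nat := count (fun r => endcol r == c) ps.
(** The jump at a column is shared equally among the paths that end there, counted with
    multiplicity. *)
Let weight r : R := gap (endcol r) / (mult (endcol r))%:R.

(* [left r a b] says that the box [(a, b)] lies above and to the left of [r]:
   the path is then to the right of the box where it crosses the antidiagonal
   through the box. *)
Let left r (a b : nat) : bool := (a <= col r (a + b).-1)%N.
Let U (a b : nat) : R := L n + \sum_(r <- ps) weight r * (left r a b)%:R.

Let enters_h (a b : nat) r : bool :=
  (col r (a + b).-1 == a.-1) && (col r (a + b) == a).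
Let enters_v (a b : nat) r : bool :=
  (col r (a + b).-1 == a) && (col r (a + b) == a).

Lemma path_to_level a : is_level k a -> (a <= n)%N ->
  exists2 r, r \in ps & endcol r = a :> nat.
Proof.
move=> la an; have [||v v1 v2] := vertex_of_coords n a (n - a) => //; first by lia.
have : v \in g.1.
  by apply: g_terminal; rewrite (terminalE _ _ sum_k) v1 v2 subnKC ?eqxx.
rewrite g_vertices inE => /hasP[r rps /(nthP (origin n))[t]].
rewrite /= ltnS (pos_path_size _ _ sum_k _ (pos _ rps)) => tn tv.
exists r => //; rewrite -colE //.
have := pos_path_level _ _ sum_k _ (pos _ rps) t tn; rewrite tv v1 v2 subnKC // => tE.
by rewrite -tE in tv; rewrite /col /path_col tv.
Qed.

Lemma gap_ge0 c : 0 <= gap c.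
Proof.
by rewrite /gap; case: ifP => // /(lamat_step _ _ _ _ sum_k lam_step)[h _]; rewrite subr_ge0.
Qed.

Lemma gap_gt0 c : (0 < c < n)%N -> is_level k c -> 0 < gap c.
Proof.
move=> cn lc; rewrite /gap cn subr_gt0.
by have [_ ->] := lamat_step _ _ _ _ sum_k lam_step _ cn.
Qed.

Lemma weight_ge0 r : 0 <= weight r.
Proof. by rewrite /weight divr_ge0 ?gap_ge0. Qed.

Lemma weight_gt0 r : r \in ps -> (0 < endcol r < n)%N -> 0 < weight r.
Proof.
move=> rps rn; rewrite /weight divr_gt0 ?gap_gt0 //.
  by rewrite -colE //; exact: (path_col_level _ _ sum_k _ (pos _ rps)).
by rewrite ltr0n -has_count; apply/hasP; exists r.
Qed.

Lemma sum_gap a : (0 < a <= n)%N -> \sum_(c < n.+1) gap c * (a <= c)%N%:R = L a - L n.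
Proof.
move=> /andP[a0 an].
rewrite -(big_mkord xpredT (fun c => gap c * (a <= c)%N%:R)) (@big_cat_nat _ _ _ a) //=;
  last by rewrite (leq_trans an).
rewrite big_nat big1 ?add0r => [|c /andP[_ ca]]; last by rewrite leqNgt ca mulr0.
rewrite big_nat_recr //= [X in _ + X](_ : _ = 0) ?addr0; last by rewrite /gap ltnn andbF mul0r.
rewrite -[RHS]opprB -(telescope_sumr L an) -sumrN !big_nat; apply: eq_bigr => c /andP[ac cn].
by rewrite /gap ac cn (leq_trans a0 ac) mulr1 opprB.
Qed.

(** The antidiagonal box in column [a] is to the left of exactly the paths ending in a column at
    least [a]; grouping the paths by end column gives the telescoping sum of [sum_gap]. *)
Lemma path_sum_diag a b : (0 < a)%N -> (0 < b)%N -> (a + b)%N = n.+1 -> U a b = L a.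
Proof.
move=> a0 b0 ab; have an : (0 < a <= n)%N by lia.
rewrite -[RHS](subrK (L n)) -(sum_gap _ an) addrC /U; congr (_ + _).
rewrite (eq_big_seq (fun r => weight r * (a <= endcol r)%N%:R)) => [|r rps]; last first.
  by rewrite /left ab /= colE.
rewrite (partition_big endcol xpredT) //=; apply: eq_bigr => c _.
rewrite (eq_bigr (fun=> gap c / (mult c)%:R * (a <= c)%N%:R)) => [|r /eqP rc]; last first.
  by rewrite /weight rc.
rewrite big_const_seq iter_addr_0 -/(mult c) -[LHS]mulr_natr.
have [c0|c0] := eqVneq (mult c) 0%N; last first.
  by rewrite mulrAC divfK ?pnatr_eq0.
(* When no path ends in column [c] the division by zero yields [0]. Since [g] contains every
   terminal vertex, such a [c] is not a level, and there is no jump to distribute. *)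
suff -> : gap c = 0 by rewrite !mul0r.
rewrite /gap; case: ifP => // cn; have [h1 h2] := lamat_step _ _ _ _ sum_k lam_step _ cn.
apply/eqP; rewrite subr_eq0 eq_le h1 andbT leNgt h2; apply/negP => lc.
have [|r rps /val_inj rc] := path_to_level c lc; first by lia.
by move/eqP: c0; rewrite -leqn0 leqNgt -has_count => /hasP[]; exists r; rewrite //= rc.
Qed.

(** The column grows by at most one per step, so a path separates the box from the one above exactly
    when it uses their common edge. *)
Lemma left_up r a b : r \in ps -> (0 < a)%N -> (0 < b)%N -> (a + b <= n)%N ->
  (left r a b.+1)%:R - (left r a b)%:R = (enters_h a b r)%:R :> R.
Proof.
move=> rps a0 b0 abn; have := path_col_step _ _ sum_k _ (pos _ rps) (a + b).-1.
rewrite prednK ?addn_gt0 ?a0 // => /(_ abn).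
rewrite /left /enters_h addnS /= -/col; move: (col r _) (col r _) => c' c cc.
have [h1|h1] := leqP a c'; have [h2|h2] := leqP a c; try by lia.
- by rewrite subrr (_ : _ && _ = false) //; lia.
- by rewrite subr0 (_ : _ && _ = true) //; lia.
- by rewrite subrr (_ : _ && _ = false) //; lia.
Qed.

Lemma left_right r a b : r \in ps -> (0 < a)%N -> (0 < b)%N -> (a + b <= n)%N ->
  (left r a b)%:R - (left r a.+1 b)%:R = (enters_v a b r)%:R :> R.
Proof.
move=> rps a0 b0 abn; have := path_col_step _ _ sum_k _ (pos _ rps) (a + b).-1.
rewrite prednK ?addn_gt0 ?a0 // => /(_ abn).
rewrite /left /enters_v addSn /= -/col; move: (col r _) (col r _) => c' c cc.
have [h1|h1] := leqP a c; have [h2|h2] := leqP a.+1 c'; try by lia.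
- by rewrite subrr (_ : _ && _ = false) //; lia.
- by rewrite subr0 (_ : _ && _ = true) //; lia.
- by rewrite subrr (_ : _ && _ = false) //; lia.
Qed.

Lemma path_sum_up a b : (0 < a)%N -> (0 < b)%N -> (a + b <= n)%N ->
  U a b.+1 - U a b = \sum_(r <- ps) weight r * (enters_h a b r)%:R.
Proof.
move=> a0 b0 abn; rewrite /U opprD addrACA subrr add0r -sumrB; apply: eq_big_seq => r rps.
by rewrite -mulrBr left_up.
Qed.

Lemma path_sum_right a b : (0 < a)%N -> (0 < b)%N -> (a + b <= n)%N ->
  U a b - U a.+1 b = \sum_(r <- ps) weight r * (enters_v a b r)%:R.
Proof.
move=> a0 b0 abn; rewrite /U opprD addrACA subrr add0r -sumrB; apply: eq_big_seq => r rps.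
by rewrite -mulrBr left_right.
Qed.

Lemma weighted_sum_ge0 (e : seq (LV n) -> bool) : 0 <= \sum_(r <- ps) weight r * (e r)%:R.
Proof. by apply: sumr_ge0 => r _; rewrite mulr_ge0 ?weight_ge0. Qed.

(** Paths ending in column [0] or [n] have weight [0] and would go undetected, hence the
    hypothesis. *)
Lemma weighted_sum_gt0 (e : seq (LV n) -> bool) :
  (forall r, r \in ps -> e r -> (0 < endcol r < n)%N) ->
  (0 < \sum_(r <- ps) weight r * (e r)%:R) = has e ps.
Proof.
move=> eP; rewrite lt_neqAle weighted_sum_ge0 andbT eq_sym psumr_neq0; last first.
  by move=> r _; rewrite mulr_ge0 ?weight_ge0.
apply: eq_in_has => r rps /=; case er : (e r); last by rewrite mulr0 ltxx.
by rewrite mulr1 weight_gt0 // eP.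
Qed.

Let x (p : GCidx n) : R := U (sval p).1 (sval p).2.

Lemma path_point_coords a b : (0 < a)%N -> (0 < b)%N -> (a + b <= n.+1)%N -> xe R n lam x a b = U a b.
Proof. by apply: xe_of_fun; exact: path_sum_diag. Qed.

Lemma path_point_inGC : inGC R n lam x.
Proof.
move=> p; have [p1 p2 pn] := GCidx_bounds n p.
rewrite !path_point_coords ?addnS ?addSn ?(leqW pn) //; split.
  by rewrite -subr_ge0 path_sum_up // weighted_sum_ge0.
by rewrite -subr_ge0 path_sum_right // weighted_sum_ge0.
Qed.

Lemma path_point_hstrict a b : (0 < a)%N -> (a + b <= n)%N ->
  hstrict R n lam x a b = has (enters_h a b) ps.
Proof.
move=> a0 abn; rewrite /hstrict a0 abn /=; case: (posnP b) => [b0|b0] /=.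
  (* A path ending in column [n] makes only horizontal steps, so it covers the whole axis. *)
  apply/esym/hasP; have [r rps rn] := path_to_level n (is_leveln _ _ sum_k) (leqnn n).
  exists r => //; rewrite b0 addn0 in abn *.
  have m s t := path_col_mono _ _ sum_k _ (pos _ rps) s t; rewrite -/col in m.
  have c0 : col r 0 = 0%N by [].
  have := m 0%N a isT abn; have := m 0%N a.-1 isT ltac:(lia).
  have := m a n abn (leqnn n); have := m a.-1 n ltac:(lia) (leqnn n).
  by rewrite colE // rn c0 /enters_h addn0; lia.
rewrite !path_point_coords ?addnS ?(leqW abn) // -subr_gt0 path_sum_up //.
(* A path through [(a, b)] ends in a column between [a] and [n - b], hence strictly between [0] and
   [n]. *)
apply: weighted_sum_gt0 => r rps /andP[/eqP e1 /eqP e2].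
have := path_col_mono _ _ sum_k _ (pos _ rps) (a + b) n abn (leqnn n).
by rewrite -/col colE // e2; lia.
Qed.

Lemma path_point_vstrict a b : (0 < b)%N -> (a + b <= n)%N ->
  vstrict R n lam x a b = has (enters_v a b) ps.
Proof.
move=> b0 abn; rewrite /vstrict b0 abn /=; case: (posnP a) => [a0|a0] /=.
  apply/esym/hasP; have [r rps rn] := path_to_level 0 (is_level0 k) (leq0n n).
  exists r => //; rewrite a0 add0n in abn *.
  have m s t := path_col_mono _ _ sum_k _ (pos _ rps) s t; rewrite -/col in m.
  have := m b n abn (leqnn n); have := m b.-1 n ltac:(lia) (leqnn n).
  by rewrite colE // rn /enters_v add0n; lia.
rewrite !path_point_coords ?addSn ?(leqW abn) // -subr_gt0 path_sum_right //.
apply: weighted_sum_gt0 => r rps /andP[/eqP e1 /eqP e2].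
have := path_col_mono _ _ sum_k _ (pos _ rps) (a + b) n abn (leqnn n).
by rewrite -/col colE // e2; lia.
Qed.

Lemma path_point_edges : g.2 = (ladder_graph n (hstrict R n lam x) (vstrict R n lam x)).2.
Proof.
apply/setP => -[u v]; rewrite g_edges inE.
have [/andP[uv un]|no] := boolP (qstep n u v && (u.1 + u.2 < n)%N); last first.
  rewrite (_ : has _ _ = false); last first.
    apply/hasP => -[r rps /mem_path_edges[t]].
    rewrite (pos_path_size _ _ sum_k _ (pos _ rps)) => tn [e1 e2]; case/negP: no.
    have := pos_path_level _ _ sum_k _ (pos _ rps) t (ltnW tn).
    have := pos_path_step _ _ sum_k _ (pos _ rps) t tn.
    by rewrite e1 e2 => -> ->.
  apply/esym; apply: contraNF no => uv.
  rewrite (ladder_graph_qstep _ _ _ _ _ uv) /=; move: uv; rewrite inE /=.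
  by move=> /orP[]/and3P[/eqP e1 /eqP e2] /and3P[_ + _]; lia.
have -> : has (fun r => (u, v) \in zip (origin n :: r) r) ps =
    has (fun r => (col r (u.1 + u.2) == u.1) && (col r (u.1 + u.2).+1 == v.1)) ps.
  by apply: eq_in_has => r rps; rewrite (mem_path_edges_col _ _ sum_k _ (pos _ rps)).
rewrite inE /=; case/orP: (uv) => /andP[/eqP e1 /eqP e2].
  rewrite e1 e2 !eqxx /= [X in X && _](_ : _ = false) /=; last by rewrite ltn_eqF.
  rewrite path_point_vstrict ?addnS //.
  by apply: eq_has => r; rewrite /enters_v !addnS.
rewrite e1 e2 !eqxx /= [X in _ || X && _](_ : _ = false) ?orbF; last by rewrite gtn_eqF.
by rewrite path_point_hstrict ?addSn.
Qed.

(** Away from the origin the vertices on both sides are the targets of edges, so the equality of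
    edge sets suffices. *)
Lemma path_point_vertices : g.1 = (ladder_graph n (hstrict R n lam x) (vstrict R n lam x)).1.
Proof.
have HV := inGC_flow_pattern _ _ _ _ sum_k lam_step _ path_point_inGC.
apply/setP => v; rewrite g_vertices inE; have [->|vo] := eqVneq v (origin n).
  rewrite inE eqxx; apply/hasP; have [r rps _] := path_to_level 0 (is_level0 k) (leq0n n).
  by exists r; rewrite // inE eqxx.
apply/hasP/idP => [[r rps]|vg].
  rewrite inE (negbTE vo) /= => /(mem_path_target _ (origin n))[u uv].
  have : (u, v) \in g.2 by rewrite g_edges inE; apply/hasP; exists r.
  by rewrite path_point_edges => /flow_edge_target.
have [u uv] : exists u, (u, v) \in g.2.
  rewrite path_point_edges; have [r] := flow_path_from_origin _ _ sum_k _ _ HV _ vg.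
  case/lastP: r => [_ ov|r w]; first by rewrite -ov eqxx in vo.
  by rewrite rcons_path last_rcons => /andP[_ e] <-; exists (last (origin n) r).
move: uv; rewrite g_edges inE => /hasP[r rps uv]; exists r => //.
by rewrite inE; apply/orP; right; apply/(mem_path_target _ (origin n)); exists u.
Qed.

Lemma Gface_point : exists2 y, inGC R n lam y &
  g = ladder_graph n (hstrict R n lam y) (vstrict R n lam y).
Proof.
exists x; first exact: path_point_inGC.
by rewrite [LHS]surjective_pairing path_point_vertices path_point_edges.
Qed.

End FaceToPoint.

(** * The isomorphism of face posets *)

Theorem theorem1p1 (R : realFieldType) (k : seq nat) (n : nat) (lam : 'I_n -> R)
  (hk : all (fun a => (0 < a)%N) k) (hn : sumn k = n)
  (hlam : forall i j : 'I_n, val j = (val i).+1 ->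
     if (val i).+1 \in [seq nl k l | l <- iota 1 (size k).-1]
     then lam j < lam i else lam j == lam i) :
  exists phi : ((GCidx n -> R) -> Prop) -> gsub n,
    (forall F, is_Pface R n lam F -> is_Gface k n (phi F)) /\
    (forall F F', is_Pface R n lam F -> is_Pface R n lam F' ->
        phi F = phi F' -> forall x, F x <-> F' x) /\
    (forall g, is_Gface k n g -> exists F, is_Pface R n lam F /\ phi F = g) /\
    (forall F F', is_Pface R n lam F -> is_Pface R n lam F' ->
        ((forall x, F x -> F' x) <-> gsubset n (phi F) (phi F'))) /\
    (forall F, is_Pface R n lam F -> affdim R n F (gdim n (phi F))).
Proof.
(* Collecting strict inequalities over all points of [F] avoids choosing a generic point; on a face,
   a generic point attains all of them at once, which is [phiE]. *)
pose phi F := ladder_graph n (fun a b => `[< exists2 x, F x & hstrict R n lam x a b >])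
                             (fun a b => `[< exists2 x, F x & vstrict R n lam x a b >]).
pose graph x := ladder_graph n (hstrict R n lam x) (vstrict R n lam x).
pose face x y := inGC R n lam y /\ tight_le R n lam y x.
have phiE F x : (forall y, F y <-> face x y) -> inGC R n lam x -> phi F = graph x.
  move=> Fx Px.
  have tl y : F y -> (forall a b, hstrict R n lam y a b -> hstrict R n lam x a b) /\
                     (forall a b, vstrict R n lam y a b -> vstrict R n lam x a b).
    by move=> /Fx[Py /(tight_le_strict _ _ _ _ _ Px Py)].
  have Fxx : F x by apply/Fx; split.
  have eH a b : `[< exists2 y, F y & hstrict R n lam y a b >] = hstrict R n lam x a b.
    by apply/asboolP/idP => [[y /tl[h _]]|]; [exact: h|exists x].
  have eV a b : `[< exists2 y, F y & vstrict R n lam y a b >] = vstrict R n lam x a b.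
    by apply/asboolP/idP => [[y /tl[_ h]]|]; [exact: h|exists x].
  by congr (_, _); apply/setP => e; rewrite !inE ?eH ?eV.
have generic F : is_Pface R n lam F ->
    exists x, [/\ inGC R n lam x, phi F = graph x & forall y, F y <-> face x y].
  move=> /Pface_generic[x Fx FE]; have Px : inGC R n lam x by case/FE: Fx.
  by exists x; split=> //; exact: phiE.
have flow x (Px : inGC R n lam x) := inGC_flow_pattern _ _ _ _ hn hlam x Px.
have tightP x y : inGC R n lam x -> inGC R n lam y ->
    tight_le R n lam y x <-> (graph y).2 \subset (graph x).2.
  move=> Px Py; rewrite tight_le_strict //; split=> [[hH hV]|/subsetP sub].
    apply/subsetP => e; rewrite !inE => /orP[]/and3P[-> ->] /=.
      by move/hH ->.
    by move/hV ->; rewrite orbT.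
  (* An edge determines its direction and its target, so both patterns can be read off from the edge
     set. *)
  split=> a b ab.
    have /andP[a0 abn] := flow_hdom _ _ _ _ (flow y Py) _ _ ab.
    have [||u u1 u2] := vertex_of_coords n a.-1 b; [lia|lia|].
    have [||v v1 v2] := vertex_of_coords n a b; [lia|lia|].
    have := sub (u, v); rewrite !inE /= u1 u2 v1 v2 prednK // !eqxx ab => /(_ isT).
    by rewrite (_ : (a == a.-1 :> nat) = false) ?orbF //; lia.
  have /andP[b0 abn] := flow_vdom _ _ _ _ (flow y Py) _ _ ab.
  have [||u u1 u2] := vertex_of_coords n a b.-1; [lia|lia|].
  have [||v v1 v2] := vertex_of_coords n a b; [lia|lia|].
  have := sub (u, v); rewrite !inE /= u1 u2 v1 v2 prednK // !eqxx ab orbT => /(_ isT).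
  by rewrite (_ : (a == a.+1 :> nat) = false) //; lia.
have phi_le F F' : is_Pface R n lam F -> is_Pface R n lam F' ->
    (phi F).2 \subset (phi F').2 -> forall x, F x -> F' x.
  move=> /generic[x [Px -> Fx]] /generic[x' [Px' -> Fx']] /tightP tx y /Fx[Py yx].
  by apply/Fx'; split=> // q /tx - /(_ Px' Px); exact: yx.
exists phi; split; [|split; [|split; [|split]]].
- by move=> F /generic[x [Px -> _]]; apply: flow_is_Gface => //; exact: flow.
- by move=> F F' PF PF' e x; split; apply: phi_le; rewrite // e.
- move=> g [gt [ps [pps [g1 g2]]]].
  have [x Px gx] := Gface_point _ _ _ _ hn hlam _ _ gt pps g1 g2.
  by exists (face x); split; [exact: tight_is_Pface|rewrite gx; exact: phiE].
- move=> F F' PF PF'; split=> [FF'|/andP[_]]; last exact: phi_le.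
  have H (P : (GCidx n -> R) -> bool) : `[< exists2 x, F x & P x >] ->
      `[< exists2 x, F' x & P x >].
    by move=> /asboolP[x /FF' F'x hx]; apply/asboolP; exists x.
  apply/andP; split; apply/subsetP => e; rewrite !inE.
    by move=> /or3P[->|/H ->|/H ->]; rewrite ?orbT.
  by move=> /orP[]/and3P[-> -> /H ->]; rewrite ?orbT.
- move=> F /generic[x [Px -> Fx]]; rewrite /graph (gdim_free_boxes _ _ _ _ hn hlam) //; split.
    have [pts [pF indep]] := tight_aff_indep _ _ _ _ hn hlam _ Px.
    by exists pts; split=> // i; apply/Fx.
  move=> [pts [pF]]; apply: (tight_aff_dep _ _ _ _ _ _ Px) => // i.
  by apply/Fx.
Qed.
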